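(* Let $(M,g)$ be a connected Riemannian homogeneous space, $r_M=\sup_{x,y\in M}d_g(x,y)$, and let $\phi:[0,r_M]\to[0,\infty)$ be nonnegative, increasing and continuous. Put $\tilde f(x;\alpha,\phi)=e^{-\phi(d_g(x,\alpha))}$ for $x,\alpha\in M$, and assume that $\tilde f(\cdot;\alpha,\phi)$ is integrable over $M$ for some $\alpha\in M$. Then: (1) $\tilde f(\cdot;\tilde\alpha,\phi)$ is integrable over $M$ for all $\tilde\alpha\in M$. (2) The normalizing constant $Z(\alpha,\phi)=\int_M\tilde f(x;\alpha,\phi)\,\mathrm{dvol}(x)$ is independent of $\alpha\in M$; denote it by $Z(\phi)$. (3) Let $f(x;\alpha,\phi)=\frac{1}{Z(\phi)}e^{-\phi(d_g(x,\alpha))}$, where $\phi$ is considered fixed and known. Then the maximum likelihood estimator of $\alpha\in M$ based on $n$ independent samples $x_1,\dots,x_n$ from $f$ is given by $$\alpha^{\mathrm{MLE}}=\operatorname*{argmin}_{\alpha\in M}\sum_{i=1}^n\phi(d_g(x_i,\alpha)).$$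
   Context: A Riemannian manifold $(M,g)$ is homogeneous if for any $x,y\in M$ there is an isometry $F$ of $M$ with $F(x)=y$. $d_g$ is the geodesic distance and $\mathrm{dvol}$ the Riemannian volume measure. The interval $[0,r_M]$ is interpreted as $[0,\infty)$ when $r_M=\infty$. ''Increasing'' means nondecreasing (constant functions are allowed). The maximum likelihood estimator is the maximizer over $\alpha\in M$ of the likelihood $\prod_{i=1}^n f(x_i;\alpha,\phi)$; argmin denotes the set of (or any) minimizers. *)

(* Defs.v *)
From HB Require Import structures.
From mathcomp Require Import all_boot all_order all_algebra.
From mathcomp Require Import all_classical all_reals all_analysis.
From mathcomp Require Import measurable_realfun.

Set Implicit Arguments.
Unset Strict Implicit.
Unset Printing Implicit Defensive.

Import Order.TTheory GRing.Theory Num.Theory.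
Import numFieldNormedType.Exports.

Local Open Scope classical_set_scope.
Local Open Scope ring_scope.

Notation borel T := (g_sigma_algebraType (@open T)).

(* The library has no canonical sigma-finite instance on [m1 \x m2]. *)
Lemma product_sigma_finite d1 d2 (T1 : measurableType d1)
    (T2 : measurableType d2) (R : realType)
    (m1 : {sigma_finite_measure set T1 -> \bar R})
    (m2 : {sigma_finite_measure set T2 -> \bar R}) :
  sigma_finite [set: T1 * T2] (m1 \x m2)%E.
Proof.
have /sigma_finiteP[F [TF ndF Foo]] := sigma_finiteT m1.
have /sigma_finiteP[G [TG ndG Goo]] := sigma_finiteT m2.
exists (fun n => F n `*` G n) => [|k].
  rewrite -setXTT TF TG predeqE => -[x y]; split.
    move=> [/= [n _ Fnx] [k _ Gky]]; exists (maxn n k) => //; split.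
    - by move: x Fnx; exact/subsetPset/ndF/leq_maxl.
    - by move: y Gky; exact/subsetPset/ndG/leq_maxr.
  by move=> [n _ []/= ? ?]; split; exists n.
have [mF Fk] := Foo k; have [mG Gk] := Goo k.
split; first exact: measurableX.
by rewrite product_measure1E// lte_mul_pinfty// ge0_fin_numE.
Qed.

Section lebesgue_rV.
Variable R : realType.
Local Notation E n := (borel 'rV[R]_n).

Definition rV_cons n (p : measurableTypeR R * E n) : E n.+1 :=
  row_mx (const_mx p.1 : 'rV[R]_1) (p.2 : 'rV[R]_n).
Definition rV_uncons n (v : E n.+1) : measurableTypeR R * E n :=
  (lsubmx (v : 'rV[R]_(1 + n)) ord0 ord0, rsubmx (v : 'rV[R]_(1 + n))).

Lemma rV_cons0 n p : (rV_cons p : 'rV[R]_n.+1) ord0 ord0 = p.1.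
Proof.
rewrite (_ : ord0 = @lshift 1 n ord0 :> 'I_n.+1); last exact: val_inj.
by rewrite (@row_mxEl _ 1 1 n) mxE.
Qed.

Lemma rV_consS n p j :
  (rV_cons p : 'rV[R]_n.+1) ord0 (lift ord0 j) = (p.2 : 'rV[R]_n) ord0 j.
Proof.
rewrite (_ : lift ord0 j = @rshift 1 n j :> 'I_n.+1); last exact: val_inj.
by rewrite (@row_mxEr _ 1 1 n).
Qed.

Lemma rV_consK n : cancel (@rV_cons n) (@rV_uncons n).
Proof.
move=> [a v]; rewrite /rV_cons /rV_uncons; congr pair; last exact: row_mxKr.
by rewrite row_mxKl mxE.
Qed.

Lemma open_rV_bigcup n (U : set 'rV[R]_n) : open U ->
  U = \bigcup_(i in [set i : 'rV[rat]_n * nat |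
         ball (map_mx ratr i.1 : 'rV[R]_n) i.2.+1%:R^-1 `<=` U])
       ball (map_mx ratr i.1 : 'rV[R]_n) i.2.+1%:R^-1.
Proof.
move=> oU; apply/seteqP; split => [v Uv|v [i /= + ?]]; last exact.
move: oU; rewrite openE => /(_ _ Uv)/nbhs_ballP[e /= e0 eU].
pose N := Num.truncn (e / 2)^-1.
have N0 : (0 : R) < N.+1%:R^-1 by rewrite invr_gt0.
have Ne : N.+1%:R^-1 < e / 2.
  by rewrite -ltf_pV2 ?posrE ?divr_gt0// invrK truncnS_gt.
have qP (j : 'I_n) : exists q : rat, ball (ratr q : R) N.+1%:R^-1 (v ord0 j).
  have [x [/= vx [q _ qx]]] := @dense_rat R (ball (v ord0 j) N.+1%:R^-1)
    (ex_intro _ _ (ballxx _ N0)) (@ball_open _ _ _ _).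
  by exists q; apply: ball_sym; rewrite qx.
have [q qv] := choice qP.
have bv : ball (map_mx ratr (\row_j q j) : 'rV[R]_n) N.+1%:R^-1 v.
  by split=> // i j; rewrite !mxE ord1.
exists (\row_j q j, N) => //= w bw; apply: eU.
have le_b (x : 'rV[R]_n) := @le_ball _ _ x _ _ (ltW Ne).
rewrite [e]splitr; apply: ball_triangle (le_b _ _ bw).
by apply: ball_sym; exact: le_b.
Qed.

Lemma measurable_rV_cons n : measurable_fun setT (@rV_cons n).
Proof.
apply: (@measurability _ _ (measurableTypeR R * E n)%type (E n.+1) setT _
  (@open 'rV[R]_n.+1)) => // _ [U oU <-]; rewrite setTI.
rewrite (open_rV_bigcup oU) preimage_bigcup bigcup_mkcond.
apply: countable_bigcupT_measurable => // -[q k]; case: ifP => // _.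
set r : R := k.+1%:R^-1; pose Q : 'rV[R]_(1 + n) := map_mx ratr q.
rewrite (_ : _ @^-1` _ = ball (lsubmx Q ord0 ord0) r `*` ball (rsubmx Q) r).
  apply: measurableX; first exact: measurable_ball.
  by apply: sub_sigma_algebra; exact: ball_open.
have r0 : 0 < r by rewrite invr_gt0.
apply/seteqP; split => [[a v] /= [_ qav]|[a v] /= [+ [_ qv]]].
- split; last split=> // i j.
  + by have := qav ord0 (@lshift 1 n ord0); rewrite (@row_mxEl _ 1 1 n) !mxE.
  + by have := qav i (@rshift 1 n j); rewrite (@row_mxEr _ 1 1 n) !mxE.
- rewrite !mxE => qa; split=> // i j; rewrite -[j](@fintype.splitK 1 n) ord1.
  case: (fintype.split (j : 'I_(1 + n))) => {}j /=.
  + by rewrite (@row_mxEl _ 1 1 n) ord1 !mxE.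
  + by have := qv ord0 j; rewrite (@row_mxEr _ 1 1 n) !mxE.
Qed.

Lemma continuous_borel (T U : ptopologicalType) (f : T -> U) : continuous f ->
  measurable_fun [set: borel T] (f : borel T -> borel U).
Proof.
move=> /continuousP cf.
apply: (@measurability _ _ (borel T) (borel U) setT _ (@open U)) => //.
by move=> _ [V oV <-]; rewrite setTI; apply: sub_sigma_algebra; exact: cf.
Qed.

Lemma measurable_rV_uncons n : measurable_fun setT (@rV_uncons n).
Proof.
apply: measurable_fun_pair => /=.
- apply: (measurability _ (RGenOpens.measurableE R)) => //.
  move=> _ [_ [a [b ->] <-]]; rewrite setTI; apply: sub_sigma_algebra.
  have /continuousP := @coord_continuous R 1 (1 + n) ord0 (@lshift 1 n ord0).
  move=> /(_ `]a, b[%classic (@interval_open R (BRight a) (BLeft b) isT isT)) /=.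
  by congr (open _); apply/funext => v /=; rewrite mxE.
- apply: continuous_borel => v s /nbhs_ballP[e /= e0 es].
  apply/nbhs_ballP; exists e => //= w [_ vw]; apply: es; split=> // i j.
  by rewrite !mxE.
Qed.

Section measure_cons.
Variables (n : nat) (m : {sigma_finite_measure set (E n) -> \bar R}).

Definition measure_cons : set (E n.+1) -> \bar R :=
  pushforward (lebesgue_measure \x m)%E (@rV_cons n).

Let mcons : measurable_fun setT (@rV_cons n) := @measurable_rV_cons n.

Let measure_cons0 : measure_cons set0 = 0%E.
Proof. by rewrite /measure_cons /pushforward preimage_set0 measure0. Qed.

Let measure_cons_ge0 A : (0 <= measure_cons A)%E.
Proof. exact: measure_ge0. Qed.

Let measure_cons_sigma_additive : semi_sigma_additive measure_cons.
Proof. exact: (@measure_semi_sigma_additive _ _ _ (pushforward _ _)). Qed.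

HB.instance Definition _ := isMeasure.Build _ _ _ measure_cons
  measure_cons0 measure_cons_ge0 measure_cons_sigma_additive.

Let measure_cons_sigma_finite : sigma_finite setT measure_cons.
Proof.
have [F TF Foo] := product_sigma_finite (@lebesgue_measure R) m.
exists (fun k => @rV_uncons n @^-1` F k).
  by rewrite -preimage_bigcup -TF.
move=> k; have [mF Fk] := Foo k; split.
  by rewrite -[X in measurable X]setTI; exact: measurable_rV_uncons.
rewrite /measure_cons /pushforward -comp_preimage.
by rewrite (_ : _ \o _ = id)// funeqE; exact: rV_consK.
Qed.

HB.instance Definition _ := Measure_isSigmaFinite.Build _ _ _ measure_cons
  measure_cons_sigma_finite.

End measure_cons.

Fixpoint lebesgue_rV n : {sigma_finite_measure set (E n) -> \bar R} :=
  if n is n'.+1 then measure_cons (lebesgue_rV n')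
  else @dirac _ (E 0) (0 : 'rV[R]_0) R.

Lemma lebesgue_rV_box n (a b : 'rV[R]_n) :
  (forall i, a ord0 i <= b ord0 i) ->
  lebesgue_rV n [set v : 'rV[R]_n | forall i, a ord0 i <= v ord0 i <= b ord0 i]
  = (\prod_i (b ord0 i - a ord0 i))%:E.
Proof.
elim: n a b => [|n IHn] a b ab /=.
  by rewrite big_ord0 diracE mem_set// => -[].
rewrite /measure_cons /pushforward.
pose box m (u w : 'rV[R]_m) :=
  [set v : 'rV[R]_m | forall i, u ord0 i <= v ord0 i <= w ord0 i].
have mbox m (u w : 'rV[R]_m) : measurable (box m u w : set (E m)).
  rewrite -[X in measurable X]setCK; apply: measurableC.
  apply: sub_sigma_algebra; apply: closed_openC.
  rewrite (_ : box m u w =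
      \bigcap_i ((fun v : 'rV[R]_m => v ord0 i) @^-1` `[u ord0 i, w ord0 i])).
    apply: closed_bigI => i _; apply: closed_comp => [v _|].
      exact: coord_continuous.
    exact: itv_closed.
  apply/seteqP; split=> v /= uvw i; first by move=> _; rewrite /= in_itv/= uvw.
  by have := uvw i Logic.I; rewrite /= in_itv.
pose a' : 'rV[R]_n := \row_i a ord0 (lift ord0 i).
pose b' : 'rV[R]_n := \row_i b ord0 (lift ord0 i).
rewrite (_ : _ @^-1` _ =
  `[a ord0 ord0, b ord0 ord0]%classic `*` box n a' b'); last first.
  apply/seteqP; split=> -[x v] /=.
    move=> xv; split=> [|i]; first by have := xv ord0; rewrite rV_cons0 in_itv.
    by have := xv (lift ord0 i); rewrite rV_consS !mxE.
  move=> [xab vab] i; case: (unliftP ord0 i) => [j ->|->].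
    by rewrite rV_consS; have := vab j; rewrite !mxE.
  by rewrite rV_cons0; move: xab; rewrite in_itv.
rewrite product_measure1E//=; [|exact: mbox].
rewrite IHn; last by move=> i; rewrite !mxE.
rewrite lebesgue_measure_itv/= lte_fin big_ord_recl EFinM.
congr (_ * _)%E; last by congr EFin; apply: eq_bigr => i _; rewrite !mxE.
have [//|ba] := ltP.
have -> : b ord0 ord0 = a ord0 ord0 by apply/eqP; rewrite eq_le ba ab.
by rewrite subrr.
Qed.

End lebesgue_rV.

Section smooth.
Context {R : realType} {V W : normedModType R}.

(* [U] is meant to be open, so that pointwise conditions on [U] are local. *)
Fixpoint Ck (k : nat) (U : set V) (f : V -> W) : Prop :=
  if k is k'.+1 then
    (forall x, U x -> differentiable f x) /\
    (forall v, Ck k' U (fun x => 'D_v f x))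
  else forall x, U x -> {for x, continuous f}.

Definition smooth_on (U : set V) (f : V -> W) : Prop := forall k, Ck k U f.

End smooth.

Section manifold.
Context {R : realType} {n : nat} {M : ptopologicalType}.

(* [coord] and [icoord] are total functions; they are only meaningful on [dom]
   and on [coord @` dom] respectively. *)
Record chart := Chart {
  dom : set M ;
  coord :> M -> 'rV[R]_n ;
  icoord : 'rV[R]_n -> M ;
  dom_open : open dom ;
  coord_open : open (coord @` dom) ;
  coordK : {in dom, cancel coord icoord} ;
  coord_continuous_in : {in dom, continuous coord} ;
  icoord_continuous_in : {in coord @` dom, continuous icoord} }.

Definition transition (c c' : chart) : 'rV[R]_n -> 'rV[R]_n := c' \o icoord c.

Definition compatible (c c' : chart) : Prop :=
  smooth_on (c @` (dom c `&` dom c')) (transition c c') /\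
  smooth_on (c' @` (dom c `&` dom c')) (transition c' c).

End manifold.
Arguments chart R n M : clear implicits.

Record smooth_manifold (R : realType) (n : nat) (M : ptopologicalType) := {
  manifold_hausdorff : hausdorff_space M ;
  manifold_second_countable : @second_countable M ;
  atlas : set (chart R n M) ;
  atlas_cover : forall p, exists c, atlas c /\ dom c p ;
  atlas_compatible : forall c c', atlas c -> atlas c' -> compatible c c' ;
  atlas_maximal : forall c, (forall c', atlas c' -> compatible c c') -> atlas c }.

Definition argmin (T : Type) (R : realType) (f : T -> R) : set T :=
  [set x | forall y, f x <= f y].

Definition argmax (T : Type) (R : realType) (f : T -> R) : set T :=
  [set x | forall y, f y <= f x].

Section riemannian.
Context {R : realType} {n : nat} {M : ptopologicalType}.

(* [gram c y] is the matrix $(g_{ij})$ of the metric in the chart [c] at the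
   point of coordinates [y].  Tangent vectors are row vectors and
   ['d f p v = v *m 'J f p], so a bilinear form with matrix [S] pulls back along
   a map of Jacobian [J] to the one with matrix [J *m S *m J^T]. *)
Record riemannian_metric (X : smooth_manifold R n M) := {
  gram : chart R n M -> 'rV[R]_n -> 'M[R]_n ;
  gram_smooth : forall c, atlas X c -> smooth_on (c @` dom c) (gram c) ;
  gram_sym : forall c p, atlas X c -> dom c p ->
    (gram c (c p))^T = gram c (c p) ;
  gram_pos : forall c p (v : 'rV[R]_n), atlas X c -> dom c p -> v != 0 ->
    0 < (v *m gram c (c p) *m v^T) ord0 ord0 ;
  gram_transition : forall c c' p, atlas X c -> atlas X c' ->
    dom c p -> dom c' p ->
    let J := 'J (transition c c') (c p) in
    gram c (c p) = J *m gram c' (c' p) *m J^T }.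

Variables (X : smooth_manifold R n M) (g : riemannian_metric X).

Definition smooth_map (F : M -> M) : Prop :=
  continuous F /\
  forall c c', atlas X c -> atlas X c' ->
    smooth_on (c @` (dom c `&` F @^-1` dom c')) (c' \o F \o icoord c).

Definition is_isometry (F : M -> M) : Prop :=
  (exists G, [/\ cancel F G, cancel G F, smooth_map F & smooth_map G]) /\
  forall c c' p, atlas X c -> atlas X c' -> dom c p -> dom c' (F p) ->
    let J := 'J (c' \o F \o icoord c) (c p) in
    gram g c (c p) = J *m gram g c' (c' (F p)) *m J^T.

Definition homogeneous : Prop :=
  forall x y, exists F, is_isometry F /\ F x = y.

Definition smooth_curve (U : set R) (s : R -> M) : Prop :=
  [/\ open U, {in U, continuous s} &
      forall c, atlas X c -> smooth_on (U `&` s @^-1` dom c) (c \o s)].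

(* Each piece is smooth up to its end points, i.e. it extends to a smooth curve
   on an open neighbourhood of the closed subinterval. *)
Definition piecewise_smooth (a b : R) (s : R -> M) : Prop :=
  exists (k : nat) (t : nat -> R), [/\ t 0%N = a, t k = b &
    forall i, (i < k)%N -> t i < t i.+1 /\
      exists U s', [/\ `[t i, t i.+1]%classic `<=` U, smooth_curve U s' &
                       {in `[t i, t i.+1], s =1 s'}]].

Definition chart_at (p : M) : chart R n M := sval (cid (atlas_cover X p)).

(* $\sqrt{g(\dot s, \dot s)}$ ; where [s] is differentiable it does not depend on
   the chart, and the finitely many break points do not matter in
   [curve_length]. *)
Definition speed (s : R -> M) (t : R) : R :=
  let c := chart_at (s t) in
  let v := derive1 (c \o s) t in
  Num.sqrt ((v *m gram g c (c (s t)) *m v^T) ord0 ord0).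

Definition curve_length (a b : R) (s : R -> M) : \bar R :=
  (\int[lebesgue_measure]_(t in `[a, b]) (speed s t)%:E)%E.

Definition edist (x y : M) : \bar R :=
  ereal_inf [set l | exists a b s,
    [/\ piecewise_smooth a b s, s a = x, s b = y & l = curve_length a b s]].

(* On a connected manifold [edist x y] is always finite. *)
Definition dist (x y : M) : R := fine (edist x y).

Definition diameter : \bar R :=
  ereal_sup [set (dist xy.1 xy.2)%:E | xy in [set: M * M]].

(* By second countability at most one Borel measure has this property. *)
Definition is_riemannian_volume
    (vol : {measure set (borel M) -> \bar R}) : Prop :=
  forall c (A : set (borel M)), atlas X c -> measurable A -> A `<=` dom c ->
    vol A = (\int[lebesgue_rV R n]_(y in c @` A)
               (Num.sqrt (\det (gram g c y)))%:E)%E.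

Variables (vol : {measure set (borel M) -> \bar R}) (phi : R -> R).

Definition unnormalized_density (x alpha : M) : R := expR (- phi (dist x alpha)).

Definition normalizing_constant (alpha : M) : \bar R :=
  (\int[vol]_x (unnormalized_density x alpha)%:E)%E.

Definition density (Z : R) (x alpha : M) : R :=
  Z^-1 * unnormalized_density x alpha.

Definition likelihood (Z : R) (N : nat) (xs : 'I_N -> M) (alpha : M) : R :=
  \prod_(i < N) density Z (xs i) alpha.

Definition mle (Z : R) (N : nat) (xs : 'I_N -> M) : set M :=
  argmax (likelihood Z xs).

End riemannian.

(* Main.v *)
Require Import Defs.
From HB Require Import structures.
From mathcomp Require Import all_boot all_order all_algebra.
From mathcomp Require Import all_classical all_reals all_analysis.
From mathcomp Require Import measurable_realfun.

(** The integral of exp (- phi (d (x, alpha))) does not depend on alpha because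
    an isometry F carrying alpha to beta preserves both the distance and the
    volume.  Both facts rest on the maximality of the atlas: if c is a chart,
    then c \o F on the preimage of dom c is again a chart of the atlas (lemma
    pullback_chart_atlas), and the matrix of the metric in it agrees with the
    one in c (lemma gram_pullback_chart), since F read in these two charts is
    the identity.

    Volume.  The defining formula for the volume holds in every chart of the
    maximal atlas.  Written for c \o F and the preimage of A, it is literally
    the formula for c and A, so that no change of variables is to be carried
    out (lemma volume_isometry_chart).  Countably many charts cover the
    manifold, whence the volumes of A and of its preimage agree for all Borel
    A (lemma volume_isometry).

    Distance.  F carries piecewise smooth curves to piecewise smooth curves,
    by pullback of charts, and by the chain rule it preserves the speed at each
    point where the curve is differentiable.  The finitely many break points
    are negligible, so F preserves lengths (lemma curve_length_isometry),
    hence also the infimum of lengths (lemma edist_isometry).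

    Likelihood.  It equals Z^-1 ^+ N * expR (- S) where S is the sum to be
    minimised, so maximising it amounts to minimising S as soon as Z > 0.
    Positivity of Z comes down to the volume being nonzero: the determinant of
    a positive definite matrix is positive (lemma det_posdef) and a nonempty
    open set of R^n has nonzero Lebesgue measure
    (lemma lebesgue_rV_open_neq0). *)

Set Implicit Arguments.
Unset Strict Implicit.
Unset Printing Implicit Defensive.

Import Order.TTheory GRing.Theory Num.Theory.
Import numFieldNormedType.Exports.

Local Open Scope classical_set_scope.
Local Open Scope ring_scope.

(** * Positive definite matrices *)

(** On the segment from the identity to A all matrices are positive definite,
    hence invertible; the determinant along it is a polynomial without root in
    [0, 1] that equals 1 at 0, so it stays positive up to A. *)
Lemma det_posdef (R : rcfType) n (A : 'M[R]_n) :
  (forall v : 'rV_n, v != 0 -> 0 < (v *m A *m v^T) ord0 ord0) -> 0 < \det A.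
Proof.
move=> Apos; rewrite ltNge; apply/negP => detA_le0.
pose B : 'M[{poly R}]_n := (1 - 'X)%:M + 'X *: map_mx polyC A.
have BE t : (\det B).[t] = \det ((1 - t)%:M + t *: A).
  rewrite -/(horner_eval t (\det B)) -det_map_mx; congr (\det _).
  apply/matrixP => i j; rewrite !mxE.
  by rewrite /= /horner_eval hornerD hornerMn !hornerE.
have [t t01 /rootP] : exists2 t, 0 <= t <= 1 & root (- \det B) t.
  have := @poly_ivt R (- \det B) 0 1 ler01.
  rewrite !hornerN !BE subr0 subrr scale0r addr0 scale1r det1.
  rewrite (_ : 0%:M = 0) ?add0r; last first.
    by apply/matrixP => i j; rewrite !mxE mul0rn.
  rewrite oppr_le0 ler01 oppr_ge0 detA_le0 => /(_ isT)[t t01 rt].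
  by exists t => //; move: t01; rewrite inE.
rewrite hornerN BE => /eqP; rewrite oppr_eq0 => /eqP det0.
have /det0P[v v0 /(congr1 (fun w => (w *m v^T) ord0 ord0))] := introT eqP det0.
rewrite mulmxDr mulmxDl mul_mx_scalar -scalemxAr -!scalemxAl mul0mx !mxE.
move: t01 => /andP[t0 t1]; move/eqP; apply/negP; rewrite gt_eqF//.
have vv : 0 < \sum_j v ord0 j * v^T j ord0.
  have [j vj] : exists j, v ord0 j != 0 by exact/rV0Pn.
  rewrite (bigD1 j)//= ltr_wpDr ?sumr_ge0// => [i _|]; rewrite !mxE -expr2.
    exact: sqr_ge0.
  by rewrite lt_neqAle eq_sym sqrf_eq0 vj sqr_ge0.
have := Apos v v0; rewrite !mxE => vAv.
have [->|tn1] := eqVneq t 1; first by rewrite subrr mul0r add0r mul1r.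
by rewrite ltr_wpDr ?mulr_ge0 ?mulr_gt0 ?(ltW vAv)// subr_gt0 lt_neqAle tn1.
Qed.

(** * Integrals *)

Section positive_integral.
Local Open Scope ereal_scope.
Context d (T : measurableType d) (R : realType).
Variable mu : {measure set T -> \bar R}.

Lemma gt0_integral_neq0 (D : set T) (f : T -> \bar R) :
  measurable D -> measurable_fun D f -> (forall x, D x -> 0 < f x) ->
  mu D != 0 -> \int[mu]_(x in D) f x != 0.
Proof.
move=> mD mf f0; apply: contra_neq => If0.
have : \int[mu]_(x in D) `|f x| = 0.
  rewrite -[RHS]If0; apply: eq_integral => x /set_mem Dx.
  by rewrite gee0_abs// ltW// f0.
move=> /ae_eq_integral_abs-/(_ mD mf)[N [mN N0 DN]].
apply: (subset_measure0 mD mN _ N0) => x Dx; apply: DN => /= /(_ Dx) fx0.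
by have := f0 _ Dx; rewrite fx0 ltxx.
Qed.

End positive_integral.

Section integral_off_null.
Local Open Scope ereal_scope.
Context d (T : measurableType d) (R : realType).
Variable mu : {measure set T -> \bar R}.
Import HBNNSimple.

Let le_integral_off_null (N : set T) (f f' : T -> \bar R) :
  measurable N -> mu N = 0 -> (forall x, 0 <= f x) -> (forall x, 0 <= f' x) ->
  (forall x, ~ N x -> f x <= f' x) -> \int[mu]_x f x <= \int[mu]_x f' x.
Proof.
move=> mN N0 f0 f'0 ff'; rewrite !ge0_integralTE//.
apply: ge_ereal_sup => _ [h hf <-]; pose h' := proj_nnsfun h (measurableC mN).
have -> : sintegral mu h = sintegral mu h'.
  rewrite -!integralT_nnsfun; apply: ge0_ae_eq_integral => //.
  - exact/measurable_EFinP/measurable_funPT.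
  - exact/measurable_EFinP/measurable_funPT.
  - by move=> x _; rewrite lee_fin.
  - by move=> x _; rewrite lee_fin.
  exists N; split=> // x /= hx; apply: contrapT => Nx; apply: hx => _.
  by rewrite mindicE mem_set// mulr1.
apply: ereal_sup_ubound; exists h' => // x; rewrite /= mindicE.
have [/set_mem Nx|_] := boolP (x \in ~` N); last by rewrite mulr0.
by rewrite mulr1; exact: le_trans (hf x) (ff' x Nx).
Qed.

(** The integral of a nonnegative function is a supremum over the simple
    functions below it, and cutting a simple function off on a null set does not
    change its integral.  This argument reaches arbitrary nonnegative functions,
    such as the speed of a curve, whose definition chooses a chart point by
    point and so gives no direct access to measurability. *)
Lemma ge0_eq_integral_off_null (D N : set T) (f f' : T -> \bar R) :
  measurable N -> mu N = 0 ->
  (forall x, D x -> 0 <= f x) -> (forall x, D x -> 0 <= f' x) ->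
  (forall x, D x -> ~ N x -> f x = f' x) ->
  \int[mu]_(x in D) f x = \int[mu]_(x in D) f' x.
Proof.
move=> mN N0 f0 f'0 ff'; rewrite integral_mkcond [RHS]integral_mkcond.
have ffN x : ~ N x -> (f \_ D) x = (f' \_ D) x.
  by move=> Nx; rewrite /patch; case: ifPn => // /set_mem Dx; exact: ff'.
by apply/eqP; rewrite eq_le; apply/andP; split;
  apply: le_integral_off_null mN N0 _ _ _ => [x|x|x /ffN ->//];
  exact: erestrict_ge0.
Qed.

End integral_off_null.

(** * Lebesgue measure on R^n *)

Section lebesgue_rV_open.
Variable R : realType.
Local Notation E n := (borel 'rV[R]_n).

Lemma continuous_in_measurable_fun n (D : set 'rV[R]_n) (f : 'rV[R]_n -> R) :
  open D -> {in D, continuous f} ->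
  measurable_fun (D : set (E n)) (f : E n -> measurableTypeR R).
Proof.
move=> oD cf; apply: (measurability _ (RGenOpens.measurableE R)) => //.
move=> _ [_ [a [b ->] <-]]; apply: sub_sigma_algebra; rewrite openE => x.
move=> [Dx fx]; apply: filterI; first exact: open_nbhs_nbhs.
apply: cf; first exact/mem_set.
by apply: open_nbhs_nbhs; split=> //; exact: interval_open.
Qed.

(** The open set contains a cube, whose measure is known in closed form. *)
Lemma lebesgue_rV_open_neq0 n (U : set 'rV[R]_n) (v : 'rV[R]_n) :
  open U -> U v -> lebesgue_rV R n U != 0%E.
Proof.
move=> oU Uv; have : nbhs v U by exact: open_nbhs_nbhs.
move=> /nbhs_ballP[e /= e0 eU]; pose r := e / 2.
have r0 : 0 < r by rewrite divr_gt0.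
pose a : 'rV[R]_n := v - const_mx r; pose b : 'rV[R]_n := v + const_mx r.
pose box := [set w : 'rV[R]_n | forall i, a ord0 i <= w ord0 i <= b ord0 i].
have boxU : box `<=` U.
  move=> w vw; apply: eU; split=> // i j; rewrite ord1.
  have := vw j; rewrite !mxE /ball /= -ler_distlC distrC.
  by move=> /le_lt_trans; apply; rewrite /r ltr_pdivrMr// ltr_pMr// ltr1n.
have mbox : measurable (box : set (E n)).
  have -> : box = \bigcap_(i in [set: 'I_n])
      ((fun w : 'rV[R]_n => w ord0 i) @^-1` `[a ord0 i, b ord0 i]).
    apply/seteqP; split=> w /= wab i.
      by move=> _; rewrite /= in_itv/= wab.
    by have := wab i Logic.I; rewrite /= in_itv.
  rewrite -[X in measurable X]setCK; apply: measurableC.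
  apply: sub_sigma_algebra; apply: closed_openC; apply: closed_bigI => i _.
  apply: preimage_closed => [w _|]; first exact: coord_continuous.
  exact: itv_closed.
have mU : measurable (U : set (E n)) by exact: sub_sigma_algebra.
have ab i : a ord0 i <= b ord0 i.
  by rewrite !mxE lerD2l (le_trans _ (ltW r0))// oppr_le0 ltW.
apply/eqP => U0; have box0 := subset_measure0 mbox mU boxU U0.
have := esym (lebesgue_rV_box ab); rewrite [RHS]box0 => -[] /eqP.
apply/negP; rewrite gt_eqF// prodr_gt0// => i _.
by rewrite !mxE opprD opprK addrACA subrr add0r addr_gt0.
Qed.

End lebesgue_rV_open.

(** * Pullback of charts *)

Section pullback_chart.
Context {R : realType} {n : nat} {M : ptopologicalType}.
Variables (F G : M -> M).
Hypotheses (FK : cancel F G) (GK : cancel G F).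
Hypotheses (cF : continuous F) (cG : continuous G).

Lemma image_comp_preimage T (c : M -> T) (A B : set M) :
  (c \o F) @` (F @^-1` A `&` B) = c @` (A `&` G @^-1` B).
Proof.
apply/seteqP; split => _ [p [Ap Bp] <-] /=.
  by exists (F p) => //; split; rewrite /preimage /= ?FK.
by exists (G p); [split; rewrite /preimage /= ?GK|rewrite GK].
Qed.

Lemma image_comp_preimageT T (c : M -> T) (A : set M) :
  (c \o F) @` (F @^-1` A) = c @` A.
Proof.
have := image_comp_preimage c A setT.
by rewrite preimage_setT !setIT.
Qed.

Variable c : chart R n M.

Let pullback_open : open (F @^-1` dom c).
Proof. by apply: open_comp (dom_open c) => x _; exact: cF. Qed.

Let pullback_coord_open : open ((c \o F) @` (F @^-1` dom c)).
Proof. by rewrite image_comp_preimageT; exact: coord_open. Qed.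

Let pullback_coordK :
  {in F @^-1` dom c, cancel (c \o F) (G \o icoord c)}.
Proof. by move=> p /set_mem cp /=; rewrite coordK ?FK//; apply/mem_set. Qed.

Let pullback_coord_continuous : {in F @^-1` dom c, continuous (c \o F)}.
Proof.
move=> p /set_mem cp; apply: continuous_comp; first exact: cF.
by apply: coord_continuous_in; exact/mem_set.
Qed.

Let pullback_icoord_continuous :
  {in (c \o F) @` (F @^-1` dom c), continuous (G \o icoord c)}.
Proof.
rewrite image_comp_preimageT => y cy; apply: continuous_comp; last exact: cG.
exact: icoord_continuous_in.
Qed.

Definition pullback_chart : chart R n M :=
  Chart pullback_open pullback_coord_open pullback_coordK
    pullback_coord_continuous pullback_icoord_continuous.

End pullback_chart.

Section isometry.
Context {R : realType} {n : nat} {M : ptopologicalType}.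
Variable (X : smooth_manifold R n M).

Lemma chart_atP p : atlas X (chart_at X p) /\ dom (chart_at X p) p.
Proof. exact: svalP (cid (atlas_cover X p)). Qed.

Lemma nbhs_dom (c : chart R n M) p : dom c p -> nbhs p (dom c).
Proof. by move=> cp; apply: open_nbhs_nbhs; split=> //; exact: dom_open. Qed.

Lemma nbhs_coord_dom (c : chart R n M) p : dom c p ->
  nbhs (c p) (c @` dom c).
Proof.
by move=> cp; apply: open_nbhs_nbhs; split; [exact: coord_open|exists p].
Qed.

Section diffeo.
Variables (F G : M -> M).
Hypotheses (FK : cancel F G) (GK : cancel G F).
Hypotheses (sF : smooth_map X F) (sG : smooth_map X G).

Let pull := @pullback_chart R n M F G FK GK sF.1 sG.1.

(** In coordinates, the two transition maps between c \o F and c' are G and F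
    read in the charts c and c', so their smoothness is that of G and F. *)
Lemma pullback_chart_atlas (c : chart R n M) : atlas X c -> atlas X (pull c).
Proof.
move=> Xc; apply: atlas_maximal => c' Xc'; split.
  by rewrite [X in smooth_on X](image_comp_preimage FK GK); exact: sG.2.
by rewrite setIC; exact: sF.2.
Qed.

(** F \o s read in the chart c is s read in the chart c \o F of the same
    atlas. *)
Lemma smooth_curve_comp (U : set R) (s : R -> M) :
  smooth_curve X U s -> smooth_curve X U (F \o s).
Proof.
move=> [oU cs ss]; split=> //.
  by move=> t Ut; apply: continuous_comp; [exact: cs|exact: sF.1].
by move=> c Xc; exact: ss (pullback_chart_atlas Xc).
Qed.

Lemma piecewise_smooth_comp a b (s : R -> M) :
  piecewise_smooth X a b s -> piecewise_smooth X a b (F \o s).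
Proof.
move=> [k [t [t0 tk ss]]]; exists k, t; split=> // i ik.
have [tt [U [s' [IU ss' ss'E]]]] := ss i ik; split=> //.
exists U, (F \o s'); split=> //; first exact: smooth_curve_comp.
by move=> x /ss'E /= ->.
Qed.

End diffeo.

Variable g : riemannian_metric X.

(** Read in the charts c \o F and c, the isometry F is the identity near
    c (F p), so the Jacobian by which it transforms the metric is the
    identity. *)
Lemma gram_pullback_chart (F G : M -> M) (FK : cancel F G) (GK : cancel G F)
    (sF : smooth_map X F) (sG : smooth_map X G) (c : chart R n M) p :
  is_isometry g F -> atlas X c -> dom c (F p) ->
  gram g (pullback_chart FK GK sF.1 sG.1 c) (c (F p)) = gram g c (c (F p)).
Proof.
move=> [_ gF] Xc cFp; set e := pullback_chart _ _ _ _ c.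
have Xe : atlas X e by exact: pullback_chart_atlas.
have /= := gF e c p Xe Xc cFp cFp.
suff -> : 'J (c \o F \o (G \o icoord c)) (c (F p)) = 1%:M.
  by move=> ->; rewrite trmx1 mul1mx mulmx1.
have idE : {near c (F p), id =1 c \o F \o (G \o icoord c)}.
  apply: filterS (nbhs_coord_dom cFp) => _ [q cq <-] /=.
  by rewrite GK coordK//; exact/mem_set.
have [/(_ (c (F p))) dJ _] := sF.2 e c Xe Xc 1%N.
apply/row_matrixP => i; rewrite !rowE mulmx1 -deriveEjacobian; last first.
  by apply: dJ; exists p.
by rewrite -(near_eq_derive _ idE) derive_id.
Qed.

(** * Isometries preserve distances *)

(** The chain rule multiplies the coordinates of the velocity by the Jacobian of
    F, which is exactly what the transformation rule of the metric absorbs. *)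
Lemma speed_isometry (F : M -> M) (s : R -> M) (t : R) :
  is_isometry g F -> {for t, continuous s} ->
  differentiable (chart_at X (s t) \o s) t ->
  speed g (F \o s) t = speed g s t.
Proof.
move=> [[G [FK GK sF sG]] gF] cs ds; rewrite /speed /=.
set e := chart_at X (s t); set c := chart_at X (F (s t)).
have [Xe es] : atlas X e /\ dom e (s t) := chart_atP (s t).
have [Xc cFs] : atlas X c /\ dom c (F (s t)) := chart_atP (F (s t)).
pose f := c \o F \o icoord e.
have df : differentiable f (e (s t)).
  by have [+ _] := sF.2 e c Xe Xc 1%N; apply; exists (s t).
have -> : derive1 (c \o (F \o s)) t = derive1 (e \o s) t *m 'J f (e (s t)).
  have fE : {near t, c \o (F \o s) =1 f \o (e \o s)}.
    have : nbhs t (s @^-1` dom e) by apply: cs; exact: nbhs_dom.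
    by apply: filterS => u eu; rewrite /f /= coordK//; exact/mem_set.
  rewrite derive1E (near_eq_derive _ fE) -derive1E.
  rewrite derive1E'; last exact: differentiable_comp.
  by rewrite diff_comp// derive1E'// /jacobian mul_rV_lin1.
by rewrite (gF e c) // trmx_mul !mulmxA.
Qed.

Lemma smooth_curve_differentiable U (s : R -> M) (c : chart R n M) t :
  smooth_curve X U s -> atlas X c -> U t -> dom c (s t) ->
  differentiable (c \o s) t.
Proof. by move=> [_ _ ss] Xc Ut cst; have [+ _] := ss c Xc 1%N; exact. Qed.

(** At a break point the curve may fail to be differentiable, and at the end
    points a and b it may even fail to be continuous because nothing is known
    about it outside [a, b]; there the speed is a junk value.  All these points
    form a finite, hence negligible, set. *)
Lemma curve_length_isometry (F : M -> M) a b (s : R -> M) :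
  is_isometry g F -> piecewise_smooth X a b s ->
  curve_length g a b (F \o s) = curve_length g a b s.
Proof.
move=> gF [k [t [t0 tk ss]]]; rewrite /curve_length.
pose N := [set t i | i in `I_k.+1].
have cN : countable N by exact/finite_set_countable/finite_image.
apply: (@ge0_eq_integral_off_null _ (measurableTypeR R) R lebesgue_measure _ N).
- exact: countable_measurable.
- exact: countable_lebesgue_measure0.
- by move=> x _; rewrite lee_fin sqrtr_ge0.
- by move=> x _; rewrite lee_fin sqrtr_ge0.
move=> x /=; rewrite in_itv/= => /andP[ax xb] Nx; congr EFin.
have [i ik /andP[tix xti]] : exists2 i, (i < k)%N & t i < x < t i.+1.
  have NE j : (j <= k)%N -> x != t j.
    by move=> jk; apply/eqP => xt; apply: Nx; exists j.
  (* Descend from t k to the first break point beyond x. *)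
  suff H j : (j <= k)%N -> x < t j ->
      exists2 i, (i < k)%N & t i < x < t i.+1.
    by apply: (H k) => //; rewrite lt_neqAle NE// tk.
  elim: j => [|j IH] jk xtj.
    by move: xtj; rewrite t0 ltNge ax.
  have [xj|xj] := ltP x (t j); first exact: IH (ltnW jk) xj.
  by exists j => //; rewrite xtj andbT lt_neqAle eq_sym NE// ltnW.
have [_ [U [s' [IU ss' ss'E]]]] := ss i ik.
have Ux : U x by apply: IU; rewrite /= in_itv/= !ltW.
have sE : {near x, s' =1 s}.
  have : nbhs x `]t i, t i.+1[%classic.
    apply: open_nbhs_nbhs; split; first exact: interval_open.
    by rewrite /= in_itv/= tix.
  apply: filterS => y /=; rewrite in_itv/= => /andP[iy yi].
  by rewrite ss'E// in_itv/= !ltW.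
have s'x : s' x = s x by exact: nbhs_singleton sE.
apply: speed_isometry => //.
  have : {for x, continuous s'} by case: ss' => _ + _; apply; exact/mem_set.
  rewrite /prop_for /continuous_at s'x; apply: cvg_trans; exact: near_eq_cvg.
set c := chart_at X (s x).
have [Xc cs] : atlas X c /\ dom c (s x) := chart_atP (s x).
have : differentiable (c \o s') x.
  by apply: smooth_curve_differentiable ss' _ _ _ => //; rewrite s'x.
move=> /derivable1_diffP ds'; apply/derivable1_diffP.
apply: near_eq_derivable ds'; apply: filterS sE => y /= ->//.
Qed.

(** Each curve from F x to F y is the image under F of a curve from x to y, so
    both infima range over the same set of lengths. *)
Lemma edist_isometry (F : M -> M) (x y : M) :
  is_isometry g F -> Defs.edist g (F x) (F y) = Defs.edist g x y.
Proof.
move=> gF; have [[G [FK GK sF sG]] _] := gF; congr ereal_inf.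
apply/seteqP; split => _ [a [b [s [ps sa sb ->]]]].
  have pGs := piecewise_smooth_comp GK FK sG sF ps.
  exists a, b, (G \o s); split; [exact: pGs|by rewrite /= sa FK|
    by rewrite /= sb FK|].
  rewrite -(curve_length_isometry gF pGs); congr curve_length.
  by apply/funext => t /=; rewrite GK.
exists a, b, (F \o s); split; [|by rewrite /= sa|by rewrite /= sb|].
  exact: (piecewise_smooth_comp FK GK sF sG ps).
by rewrite (curve_length_isometry gF ps).
Qed.

Lemma dist_isometry (F : M -> M) (x y : M) :
  is_isometry g F -> Defs.dist g (F x) (F y) = Defs.dist g x y.
Proof. by move=> gF; rewrite /Defs.dist edist_isometry. Qed.

(** * Isometries preserve the volume *)

(** Pick, for each member of a countable basis that lies inside some chart
    domain, one such chart. *)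
Lemma countable_chart_cover :
  exists c : nat -> chart R n M,
    (forall k, atlas X (c k)) /\ \bigcup_k dom (c k) = setT.
Proof.
have [B cB [_ Bnbhs]] := manifold_second_countable X.
have basisP p : exists U, [/\ B U, U p & U `<=` dom (chart_at X p)].
  have [Xc cp] := chart_atP p.
  by have /(Bnbhs p)[U [BU Up] Uc] := nbhs_dom cp; exists U.
have [B0|[u]] := pfcard_geP cB.
  by have [U []] := basisP point; rewrite B0.
have choiceP k : exists c, atlas X c /\
    ((exists2 c', atlas X c' & u k `<=` dom c') -> u k `<=` dom c).
  have [[c' Xc' uc']|nuc] := pselect (exists2 c', atlas X c' & u k `<=` dom c').
    by exists c'.
  (* Basis members inside no chart domain get an arbitrary chart. *)
  by exists (chart_at X point); split=> //; have [] := chart_atP point.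
have [c cP] := choice choiceP.
exists c; split=> [k|]; first by have [] := cP k.
apply/seteqP; split=> // p _; have [U [BU Up Uc]] := basisP p.
have [k _ ukU] : (u @` setT) U by exact: surj.
exists k => //; have [_] := cP k; rewrite ukU; apply=> //.
by exists (chart_at X p) => //; have [] := chart_atP p.
Qed.

Variable vol : {measure set (borel M) -> \bar R}.
Hypothesis volP : is_riemannian_volume g vol.

Lemma open_measurable_borel (U : set M) :
  open U -> measurable (U : set (borel M)).
Proof. exact: sub_sigma_algebra. Qed.

(** The volume formula in the chart c \o F at the preimage of A has the same
    domain of integration and the same integrand as the one in c at A. *)
Lemma volume_isometry_chart (F : M -> M) (c : chart R n M) (A : set (borel M)) :
  is_isometry g F -> atlas X c -> measurable A -> A `<=` dom c ->
  vol (F @^-1` A) = vol A.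
Proof.
move=> gF Xc mA Ac; have [[G [FK GK sF sG]] _] := gF.
pose e := pullback_chart FK GK sF.1 sG.1 c.
have Xe : atlas X e by exact: pullback_chart_atlas.
have mFA : measurable (F @^-1` A : set (borel M)).
  by rewrite -[X in measurable X]setTI; exact: (continuous_borel sF.1).
rewrite (volP Xc mA Ac) (volP Xe mFA) => [|p /Ac //].
have -> : e @` (F @^-1` A) = c @` A :> set (borel 'rV[R]_n).
  exact: (image_comp_preimageT FK GK).
apply: eq_integral => _ /set_mem[p Ap <-].
by rewrite -(GK p) gram_pullback_chart// GK; exact: Ac.
Qed.

Lemma volume_isometry (F : M -> M) (A : set (borel M)) :
  is_isometry g F -> measurable A -> vol (F @^-1` A) = vol A.
Proof.
move=> gF; have [[G [FK GK sF sG]] _] := gF.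
have [c [Xc cT]] := countable_chart_cover.
have mF := continuous_borel sF.1.
pose volF := [the measure _ _ of pushforward vol (F : borel M -> borel M)].
have cm k : measurable (dom (c k) : set (borel M)).
  by apply: open_measurable_borel; exact: dom_open.
have := @g_sigma_algebra_measure_unique_cover _ R (borel M) (@open M) _
  (dom \o c) _ cT (volF mF) vol.
apply=> // [U|k|k B mB]; [exact: open_measurable_borel|exact: dom_open|].
apply: (volume_isometry_chart gF (Xc k)); last by move=> p [].
by apply: measurableI; [exact: cm|exact: mB].
Qed.

Lemma integral_isometry (F : M -> M) (f : borel M -> \bar R) :
  is_isometry g F -> measurable_fun setT f -> (forall x, 0 <= f x)%E ->
  (\int[vol]_x f (F x) = \int[vol]_x f x)%E.
Proof.
move=> gF mf f0; have [[G [FK GK sF sG]] _] := gF.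
have mF := continuous_borel sF.1.
rewrite -[LHS](ge0_integral_pushforward mF _ measurableT)//.
by apply: eq_measure_integral => A mA _; exact: volume_isometry.
Qed.

(** * Positivity of the volume *)

Lemma measurable_volume_density (c : chart R n M) : atlas X c ->
  measurable_fun (c @` dom c : set (borel 'rV[R]_n))
    (fun y => Num.sqrt (\det (gram g c y)) : measurableTypeR R).
Proof.
move=> Xc; have cgram := gram_smooth g Xc 0%N.
have mgram i j : measurable_fun (c @` dom c : set (borel 'rV[R]_n))
    (fun y => gram g c y i j : measurableTypeR R).
  apply: continuous_in_measurable_fun => [|y /set_mem cy]; first exact: coord_open.
  have cij : {for y, continuous (fun w : 'rV[R]_n => gram g c w i j)}.
    apply: (@continuous_comp _ _ _ (gram g c) (fun A : 'M[R]_n => A i j)).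
      exact: cgram.
    exact: coord_continuous.
  exact: cij.
apply: measurableT_comp.
  exact: continuous_measurable_fun (@sqrt_continuous R).
rewrite /determinant; apply: measurable_sum => s.
apply: measurable_funM; first exact: measurable_cst.
by apply: measurable_prod => i _; exact: mgram.
Qed.

Lemma volume_neq0 : vol [set: borel M] != 0%E.
Proof.
pose c := chart_at X point.
have [Xc cp] : atlas X c /\ dom c point := chart_atP point.
have mc : measurable (dom c : set (borel M)).
  by apply: open_measurable_borel; exact: dom_open.
suff volc : vol (dom c) != 0%E.
  apply: contra_neq volc => vol0.
  exact: (subset_measure0 mc measurableT _ vol0).
rewrite (volP Xc mc)//; apply: gt0_integral_neq0.
- by apply: sub_sigma_algebra; exact: coord_open.
- by apply/measurable_EFinP; exact: measurable_volume_density.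
- move=> _ [p cp' <-]; rewrite lte_fin sqrtr_gt0; apply: det_posdef => v v0.
  exact: gram_pos.
- apply: (lebesgue_rV_open_neq0 (v := c point)); first exact: coord_open.
  by exists point.
Qed.

End isometry.

(** * Maximum likelihood *)

Lemma argmax_likelihood (R : realType) (n : nat) (M : ptopologicalType)
    (X : smooth_manifold R n M) (g : riemannian_metric X) (phi : R -> R)
    (Z : R) (N : nat) (xs : 'I_N -> M) : 0 < Z ->
  mle g phi Z xs =
  argmin (fun alpha => \sum_(i < N) phi (Defs.dist g (xs i) alpha)).
Proof.
move=> Z0.
have likelihoodE alpha : likelihood g phi Z xs alpha =
    Z^-1 ^+ N * expR (- \sum_(i < N) phi (Defs.dist g (xs i) alpha)).
  rewrite /likelihood big_split prodr_const card_ord -sumrN.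
  by rewrite expR_sum.
apply/seteqP; split=> alpha opt beta; have := opt beta.
  by rewrite !likelihoodE ler_pM2l ?exprn_gt0 ?invr_gt0// ler_expR lerN2.
by rewrite !likelihoodE ler_pM2l ?exprn_gt0 ?invr_gt0// ler_expR lerN2.
Qed.

Theorem proposition3p4 (R : realType) (n : nat) (M : ptopologicalType)
    (X : smooth_manifold R n M) (g : riemannian_metric X)
    (vol : {measure set (borel M) -> \bar R}) (phi : R -> R) :
  let D := [set t : R | 0 <= t /\ (t%:E <= diameter g)%E] in
  connected [set: M] ->
  homogeneous g ->
  is_riemannian_volume g vol ->
  (forall t, D t -> 0 <= phi t) ->
  (forall s t, D s -> D t -> s <= t -> phi s <= phi t) ->
  {within D, continuous phi} ->
  (exists alpha, vol.-integrable [set: borel M]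
     (fun x => (unnormalized_density g phi x alpha)%:E)) ->
  (forall alpha, vol.-integrable [set: borel M]
     (fun x => (unnormalized_density g phi x alpha)%:E)) /\
  exists Z : R,
    (forall alpha, normalizing_constant g vol phi alpha = Z%:E) /\
    forall (N : nat) (xs : 'I_N -> M),
      mle g phi Z xs =
      argmin (fun alpha => \sum_(i < N) phi (dist g (xs i) alpha)).
Proof.
move=> D _ homog volP _ _ _ [alpha int_alpha].
pose f x y := (unnormalized_density g phi x y)%:E.
have f_gt0 x y : (0 < f x y)%E by rewrite lte_fin expR_gt0.
have f_ge0 x y : (0 <= f x y)%E by exact: ltW.
have fF F x y : is_isometry g F -> f (F x) (F y) = f x y.
  by move=> gF; rewrite /f /unnormalized_density dist_isometry.
(* Measurability is part of integrability at alpha, and it is carried over to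
   beta by an isometry. *)
have mf beta : measurable_fun [set: borel M] (f ^~ beta).
  have [F [gF <-]] := homog alpha beta.
  have [[G [FK GK sF sG]] _] := gF.
  rewrite (_ : f ^~ (F alpha) = f ^~ alpha \o (G : borel M -> borel M)).
    apply: (measurableT_comp _ (continuous_borel sG.1)).
    by case/integrableP : int_alpha.
  by apply/funext => x /=; rewrite -[x in LHS]GK fF.
have int_eq beta : (\int[vol]_x f x beta = \int[vol]_x f x alpha)%E.
  have [F [gF <-]] := homog alpha beta.
  rewrite -(integral_isometry volP gF (mf _))//.
  by apply: eq_integral => x _; rewrite fF.
have absE beta : (\int[vol]_x `|f x beta| = \int[vol]_x f x beta)%E.
  by apply: eq_integral => x _; rewrite gee0_abs.
have int_lty : (\int[vol]_x f x alpha < +oo)%E.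
  by rewrite -absE; case/integrableP : int_alpha.
have int_fin : (\int[vol]_x f x alpha)%E \is a fin_num.
  by rewrite ge0_fin_numE// integral_ge0.
split=> [beta|].
  apply/integrableP; split; first exact: mf.
  by rewrite [ltLHS]absE int_eq.
exists (fine (\int[vol]_x f x alpha)%E); split=> [beta|N xs].
  by rewrite fineK//; exact: int_eq.
apply: argmax_likelihood; rewrite fine_gt0// int_lty andbT lt0e integral_ge0//.
rewrite andbT; apply: (gt0_integral_neq0 measurableT (mf alpha)) => //.
exact: (volume_neq0 volP).
Qed.
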